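(* Let $k$ be a field, $V$ a finite-dimensional $k$-vector space and $G<\mathrm{GL}(V)$ a finite group. Let $U\subseteq V$ be a linear subspace and let $H=\{\sigma\in G:\ \sigma(u)=u \text{ for all } u\in U\}$ be its point-stabilizer. If the action of $G$ on $V$ has the direct summand property, then the action of $H$ on $V$ also has the direct summand property.
   Context: $k[V]$ denotes the coordinate ring of $V$, i.e. the symmetric algebra on the dual space $V^*$, graded by degree, with $G$ acting by graded algebra automorphisms; $k[V]^G$ is the ring of invariants. The action of $G$ on $V$ has the direct summand property if there is a surjective $k[V]^G$-linear map $\pi:k[V]\to k[V]^G$ respecting the gradings (equivalently, $k[V]^G$ is a direct summand of $k[V]$ as a graded $k[V]^G$-module). *)

(* Defs.v *)
From HB Require Import structures.
From mathcomp Require Import all_boot all_order all_algebra.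
Set Implicit Arguments. Unset Strict Implicit. Unset Printing Implicit Defensive.
Import GRing.Theory.
Local Open Scope ring_scope.

(* Multivariate polynomials in n variables over R, as iterated univariate
   polynomials: mpoly R 0 = R, mpoly R (m+1) = (mpoly R m)[X_m].
   Variable X_i (i < n) is mvar n i. *)
Fixpoint mpoly (R : comNzRingType) (n : nat) : comNzRingType :=
  if n is m.+1 then ({poly (mpoly R m)} : comNzRingType) else R.

Fixpoint mconst (R : comNzRingType) (n : nat) : R -> mpoly R n :=
  match n return R -> mpoly R n with
  | 0 => fun a => a
  | m.+1 => fun a => (@mconst R m a)%:P
  end.

(* the coordinate variable X_i (0 if i >= n) *)
Fixpoint mvar (R : comNzRingType) (n : nat) (i : nat) : mpoly R n :=
  match n return mpoly R n with
  | 0 => 0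
  | m.+1 => if i == m then 'X else (mvar R m i)%:P
  end.

Fixpoint meval (R : comNzRingType) (n : nat) (S : comNzRingType)
    (phi : R -> S) (s : nat -> S) : mpoly R n -> S :=
  match n return mpoly R n -> S with
  | 0 => phi
  | m.+1 => fun p => \sum_(i < size p) @meval R m S phi s (p`_i : mpoly R m) * s m ^+ i
  end.

(* homogeneity of degree d (the zero polynomial is homogeneous of every degree) *)
Fixpoint mhomog (R : comNzRingType) (n : nat) (d : nat) : mpoly R n -> bool :=
  match n return mpoly R n -> bool with
  | 0 => fun a => (a == 0) || (d == 0)%N
  | m.+1 => fun p => [forall i : 'I_(size p),
               (p`_i == 0) || ((i <= d)%N && @mhomog R m (d - i) (p`_i : mpoly R m))]
  end.

(* k[V] with V = 'rV[k]_n, X_i the i-th coordinate function.  A matrix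
   s : 'M_n acts on V by v |-> v *m s; the induced graded algebra
   automorphism of k[V] is f |-> f o s, i.e. X_i |-> sum_j s j i X_j. *)
Definition lin_form (k : fieldType) (n : nat) (s : 'M[k]_n) (i : nat) : mpoly k n :=
  match insub i with
  | Some i' => \sum_(j < n) @mconst k n (s j i') * mvar k n j
  | None => 0
  end.

Definition mact (k : fieldType) (n : nat) (s : 'M[k]_n) (f : mpoly k n) : mpoly k n :=
  @meval k n (mpoly k n) (@mconst k n) (lin_form s) f.

Definition is_invariant (k : fieldType) (n : nat) (P : 'M[k]_n -> Prop)
    (f : mpoly k n) : Prop :=
  forall s, P s -> mact s f = f.

(* Direct summand property: a surjective, graded, k[V]^G-linear map
   pi : k[V] -> k[V]^G (modelled as a map k[V] -> k[V] with image in k[V]^G). *)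
Definition direct_summand_property (k : fieldType) (n : nat)
    (P : 'M[k]_n -> Prop) : Prop :=
  exists pi : mpoly k n -> mpoly k n,
    [/\ (forall f, is_invariant P (pi f)),
        (forall f g, pi (f + g) = pi f + pi g),
        (forall a f, is_invariant P a -> pi (a * f) = a * pi f),
        (forall g, is_invariant P g -> exists f, pi f = g) &
        (forall d f, mhomog d f -> mhomog d (pi f))].

(* Main.v *)
(* Write H for the pointwise stabilizer of U, A = k[V], and let pi : A -> A^G be a
   graded A^G-linear map with pi f0 = 1.
   (1) The function g |-> E_g = \prod_(h1, h2 in H, s notin H) (h1 s x_s - g h2 x_s), where
   the coordinate x_s satisfies (s x_s - x_s)|_U <> 0, vanishes off H and is constant on H,
   with value an H-invariant e such that e|_U <> 0.  Expanding, E_g = \sum_i b_i g(a_i).  An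
   identity \sum_i b_i g(a_i) = 0 for all g in G forces \sum_i b_i pi(a_i) = 0 (Artin's
   argument), so phi_t(f) = \sum_i b_i pi(t(a_i f) f0) is A^H-linear with values in A^H for
   every t in G, and e = \sum_t phi_t(1) over representatives t^-1 of the cosets of H.
   Hence phi(1)|_U <> 0 for some phi = phi_t.
   (2) Translations along U commute with H.  Conjugating phi by the translation along a
   polynomial curve c(t) in U with phi(1)(c(t)) <> 0 and taking a coefficient in t yields an
   A^H-linear map whose value at 1 has a nonzero constant term.
   (3) The degree 0 part of this map is graded and sends 1 to a nonzero constant. *)
Require Import Defs.
From HB Require Import structures.
From mathcomp Require Import all_boot all_order all_algebra.
Set Implicit Arguments. Unset Strict Implicit. Unset Printing Implicit Defensive.
Import GRing.Theory.
Local Open Scope ring_scope.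

(** * Evaluation morphisms on iterated polynomial rings *)

Lemma mconst_is_rmorph (R : comNzRingType) n :
  zmod_morphism (@mconst R n) /\ monoid_morphism (@mconst R n).
Proof.
elim: n => [|n [IHB [IH1 IHM]]]; first by [].
by split=> [a b|]; [rewrite /= IHB polyCB | split=> [|a b]; rewrite /= ?IH1 ?IHM ?polyCM].
Qed.

HB.instance Definition _ (R : comNzRingType) n :=
  GRing.isZmodMorphism.Build _ _ (@mconst R n) (mconst_is_rmorph R n).1.
HB.instance Definition _ (R : comNzRingType) n :=
  GRing.isMonoidMorphism.Build _ _ (@mconst R n) (mconst_is_rmorph R n).2.

(** The value at 0 is a hypothesis because the lemma serves to prove that [meval] is a morphism. *)
Lemma mevalS_horner (R S : comNzRingType) n (phi : R -> S) s (p : mpoly R n.+1) :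
    meval phi s (0 : mpoly R n) = 0 ->
  meval phi s p = (map_poly (meval phi s : mpoly R n -> S) (p : {poly mpoly R n})).[s n].
Proof.
move=> f0; rewrite (@horner_coef_wide _ (size (p : {poly _}))); last exact: size_poly.
by apply: eq_bigr => i _; rewrite coef_map_id0.
Qed.

Lemma meval_is_rmorph (R S : comNzRingType) n (phi : {rmorphism R -> S}) s :
  zmod_morphism (@meval R n S phi s) /\ monoid_morphism (@meval R n S phi s).
Proof.
elim: n => [|n [IHB IHM]].
  by split=> [a b|]; [exact: rmorphB | split; [exact: rmorph1 | exact: rmorphM]].
pose fB := GRing.isZmodMorphism.Build _ _ (@meval R n S phi s) IHB.
pose fM := GRing.isMonoidMorphism.Build _ _ (@meval R n S phi s) IHM.
pose f : {rmorphism mpoly R n -> S} := HB.pack (@meval R n S phi s) fB fM.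
have E p : @meval R n.+1 S phi s p = (map_poly f p).[s n].
  by apply: mevalS_horner; exact: (rmorph0 f).
split=> [p q|]; first by rewrite !E rmorphB hornerD hornerN.
by split=> [|p q]; rewrite !E ?rmorph1 ?hornerC // rmorphM hornerM.
Qed.

HB.instance Definition _ (R S : comNzRingType) n (phi : {rmorphism R -> S}) s :=
  GRing.isZmodMorphism.Build _ _ (@meval R n S phi s) (meval_is_rmorph n phi s).1.
HB.instance Definition _ (R S : comNzRingType) n (phi : {rmorphism R -> S}) s :=
  GRing.isMonoidMorphism.Build _ _ (@meval R n S phi s) (meval_is_rmorph n phi s).2.

Lemma mevalS (R S : comNzRingType) n (phi : {rmorphism R -> S}) s (p : mpoly R n.+1) :
  meval phi s p = (map_poly (@meval R n S phi s) (p : {poly mpoly R n})).[s n].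
Proof. by apply: mevalS_horner; exact: rmorph0. Qed.

Lemma meval_mconst (R S : comNzRingType) n (phi : {rmorphism R -> S}) s c :
  @meval R n S phi s (mconst n c) = phi c.
Proof. by elim: n => // n IH; rewrite mevalS /= map_polyC hornerC; exact: IH. Qed.

Lemma meval_mvar (R S : comNzRingType) n (phi : {rmorphism R -> S}) s i :
  (i < n)%N -> @meval R n S phi s (mvar R n i) = s i.
Proof.
elim: n => // n IH; rewrite mevalS /= ltnS leq_eqVlt.
case: eqP => [->|_] /= lt_in; first by rewrite map_polyX hornerX.
by rewrite map_polyC hornerC; exact: IH.
Qed.

Lemma mpoly_rmorph_ext (R S : comNzRingType) n (f g : {rmorphism mpoly R n -> S}) :
    (forall c, f (mconst n c) = g (mconst n c)) ->
    (forall i, (i < n)%N -> f (mvar R n i) = g (mvar R n i)) ->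
  f =1 g.
Proof.
elim: n f g => [|n IH] f g eqc eqv p; first exact: eqc.
have eqC c : f (c%:P : {poly mpoly R n}) = g (c%:P : {poly mpoly R n}).
  apply: (IH (f \o polyC) (g \o polyC)) => [a|i lt_in] /=; first exact: eqc.
  have := eqv i (leqW lt_in); rewrite /=; case: eqP lt_in => // ->; by rewrite ltnn.
have eqX : f ('X : {poly mpoly R n}) = g ('X : {poly mpoly R n}).
  by have := eqv n (leqnn _); rewrite /= eqxx.
elim/poly_ind: (p : {poly mpoly R n}) => [|q c IHq]; first by rewrite !rmorph0.
by rewrite !rmorphD !rmorphM IHq eqX eqC.
Qed.

(** A predicate, because [mpoly R n] is typed only as a commutative ring. *)
Definition no_zero_divisors (R : nzRingType) :=
  forall x y : R, x * y = 0 -> x != 0 -> y = 0.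

(** By induction the leading coefficient of [p] is regular, hence so is [p]. *)
Lemma mpoly_domain (R : comNzRingType) n :
  no_zero_divisors R -> no_zero_divisors (mpoly R n).
Proof.
move=> domR; elim: n => // n IH p q pq0 p0.
have: GRing.lreg (lead_coef (p : {poly mpoly R n})).
  move=> x y /eqP; rewrite -subr_eq0 -mulrBr => /eqP /IH; rewrite lead_coef_eq0.
  by move=> /(_ p0)/eqP; rewrite subr_eq0 => /eqP.
by move/lreg_lead/(_ q 0); apply; rewrite mulr0.
Qed.


(** * Linear action on the coordinate ring *)

Section LinearAction.

Variables (k : fieldType) (n : nat).
Local Notation A := (mpoly k n).
Implicit Types (s t : 'M[k]_n) (f : A).

Lemma mpoly_field_domain : no_zero_divisors A.
Proof.
by apply: mpoly_domain => x y /eqP; rewrite mulf_eq0 => /orP[->|/eqP->].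
Qed.

Lemma prod_mpoly_neq0 (I : Type) (r : seq I) (P : pred I) (F : I -> A) :
  (forall i, P i -> F i != 0) -> \prod_(i <- r | P i) F i != 0.
Proof.
move=> F0; apply: (big_ind (fun x => x != 0)) => //; first exact: oner_neq0.
move=> x y x0 y0; apply/eqP => /mpoly_field_domain /(_ x0) /eqP.
by rewrite (negPf y0).
Qed.

Lemma mact_is_rmorph s : zmod_morphism (@mact k n s) /\ monoid_morphism (@mact k n s).
Proof. exact: (@meval_is_rmorph k A n (@mconst k n)). Qed.

HB.instance Definition _ s :=
  GRing.isZmodMorphism.Build _ _ (@mact k n s) (mact_is_rmorph s).1.
HB.instance Definition _ s :=
  GRing.isMonoidMorphism.Build _ _ (@mact k n s) (mact_is_rmorph s).2.

Lemma mact_mconst s c : mact s (mconst n c) = mconst n c.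
Proof. exact: (@meval_mconst k A n (@mconst k n)). Qed.

Lemma mact_mvar s (i : 'I_n) :
  mact s (mvar k n i) = \sum_(j < n) mconst n (s j i) * mvar k n j.
Proof.
rewrite [LHS](@meval_mvar k A n (@mconst k n)) // /lin_form.
by case: insubP => [i' _ /val_inj -> //|]; rewrite ltn_ord.
Qed.

Lemma mactM s t f : mact s (mact t f) = mact (s *m t) f.
Proof.
apply: (@mpoly_rmorph_ext k A n (@mact k n s \o @mact k n t) (mact (s *m t))) => [c|i lt_in] /=.
  by rewrite !mact_mconst.
rewrite -[i]/(val (Ordinal lt_in)) !mact_mvar rmorph_sum.
under eq_bigr => j _ do rewrite rmorphM /= mact_mconst mact_mvar mulr_sumr.
rewrite exchange_big; apply: eq_bigr => l _ /=.
rewrite mxE rmorph_sum mulr_suml; apply: eq_bigr => j _.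
by rewrite rmorphM mulrA [_ * mconst n (s _ _)]mulrC.
Qed.

Lemma mact1 f : mact 1%:M f = f.
Proof.
apply: (@mpoly_rmorph_ext k A n (@mact k n 1%:M) idfun) => [c|i lt_in] /=.
  exact: mact_mconst.
rewrite -[i]/(val (Ordinal lt_in)) mact_mvar (bigD1 (Ordinal lt_in)) //= big1 => [|j neq].
  by rewrite mxE eqxx mulr1n rmorph1 mul1r addr0.
by rewrite mxE (negPf neq) mulr0n rmorph0 mul0r.
Qed.

Lemma perm_mulmx (L : seq 'M[k]_n) s : uniq L -> s \in unitmx ->
  (forall t, t \in L -> s *m t \in L) -> perm_eq [seq s *m t | t <- L] L.
Proof.
move=> uL us cL; have uM : uniq [seq s *m t | t <- L].
  by rewrite map_inj_uniq //; apply: can_inj (mulKmx us).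
apply: uniq_perm => //; apply: (uniq_min_size uM _ _).2; last by rewrite size_map.
by move=> _ /mapP[t tL ->]; exact: cL.
Qed.

Lemma prod_mulmx (R : comNzRingType) (L : seq 'M[k]_n) s (F : 'M[k]_n -> R) :
  uniq L -> s \in unitmx -> (forall t, t \in L -> s *m t \in L) ->
  \prod_(t <- L) F (s *m t) = \prod_(t <- L) F t.
Proof.
by move=> uL us cL; rewrite -[RHS](perm_big _ (perm_mulmx uL us cL)) /= big_map.
Qed.

Definition finite_matrix_group (G : seq 'M[k]_n) :=
  [/\ 1%:M \in G, forall s t, s \in G -> t \in G -> s *m t \in G
    & forall s, s \in G -> s \in unitmx].

(** Left multiplication by [s] permutes the finite list, so it reaches the identity. *)
Lemma finite_matrix_group_inv G s :
  finite_matrix_group G -> s \in G -> invmx s \in G.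
Proof.
move=> [G1 GM GU] sG.
have /perm_mem/(_ 1%:M) : perm_eq [seq s *m t | t <- undup G] (undup G).
  by apply: perm_mulmx; rewrite ?undup_uniq ?GU // => t; rewrite !mem_undup; exact: GM.
rewrite mem_undup G1 => /mapP[t]; rewrite mem_undup => tG st1.
by rewrite -[invmx s]mulmx1 st1 mulKmx // GU.
Qed.

(** * Artin's argument for maps linear over the invariants *)

Section Artin.

Variables (G : seq 'M[k]_n) (gG : finite_matrix_group G) (pi : A -> A).
Hypothesis piD : forall f g, pi (f + g) = pi f + pi g.
Hypothesis piM : forall a f, is_invariant (fun s => s \in G) a -> pi (a * f) = a * pi f.

Lemma summand_map0 : pi 0 = 0.
Proof. by apply: (addrI (pi 0)); rewrite -piD !addr0. Qed.

Lemma summand_map_sum (I : Type) (r : seq I) (F : I -> A) :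
  pi (\sum_(i <- r) F i) = \sum_(i <- r) pi (F i).
Proof. by apply: (big_morph pi piD summand_map0). Qed.

(* Induction on the number of nonzero b_i: Artin's argument on the linear independence
   of conjugates, in denominator-free form. *)
Lemma invariant_linear_conjugates (I : finType) (a b : I -> A) :
    (forall s, s \in G -> \sum_i b i * mact s (a i) = 0) ->
  \sum_i b i * pi (a i) = 0.
Proof.
case: (gG) => G1 GM GU.
have [m] := ubnP #|[set i | b i != 0]|; elim: m b => // m IH b leb brel.
have [i0 bi0|b0] := pickP (fun i => b i != 0); last first.
  by apply: big1 => i _; move/negbFE: (b0 i) => /eqP ->; rewrite mul0r.
have IH' (b' : I -> A) i1 : b i1 != 0 -> b' i1 = 0 ->
    (forall i, b i = 0 -> b' i = 0) ->
    (forall s, s \in G -> \sum_i b' i * mact s (a i) = 0) ->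
  \sum_i b' i * pi (a i) = 0.
  move=> bi1 b'i1 sub; apply: IH; rewrite -ltnS; apply: leq_trans leb; rewrite ltnS.
  apply: proper_card; apply/properP; split.
    by apply/subsetP => i; rewrite !inE; apply: contra => /eqP /sub ->.
  by exists i1; rewrite !inE ?bi1 // b'i1 eqxx.
have conj_rel s t : s \in G -> t \in G -> \sum_i mact s (b i) * mact t (a i) = 0.
  move=> sG tG; have := brel _ (GM _ _ (finite_matrix_group_inv gG sG) tG).
  move/(congr1 (mact s)); rewrite rmorph0 rmorph_sum => eq0; rewrite -[RHS]eq0.
  apply: eq_bigr => i _; rewrite rmorphM; congr (_ * _).
  by rewrite /= mactM mulmxA mulmxV ?mul1mx // GU.
have comb_rel (c d : A) (b1 b2 : I -> A) (x : I -> A) :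
  \sum_i (c * b1 i - d * b2 i) * x i = c * (\sum_i b1 i * x i) - d * (\sum_i b2 i * x i).
  by rewrite !mulr_sumr -sumrB; apply: eq_bigr => i _; rewrite mulrBl !mulrA.
(* Either some [s] moves a ratio [b i / b i0], and elimination gives relations of smaller support:
   [b'] vanishes at [i0], and [b' i1 * b - b i1 * b'] vanishes at [i1]. Or all these ratios are
   invariant. *)
have [/hasP[s sG /existsP[i1 ni1]]|/hasPn prop] :=
    boolP (has (fun s => [exists i, b i0 * mact s (b i) - mact s (b i0) * b i != 0]) G).
  pose b' i := b i0 * mact s (b i) - mact s (b i0) * b i.
  have b'b i : b i = 0 -> b' i = 0 by rewrite /b' => ->; rewrite rmorph0 !mulr0 subrr.
  have b'rel t : t \in G -> \sum_i b' i * mact t (a i) = 0.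
    by move=> tG; rewrite comb_rel conj_rel // brel // !mulr0 subrr.
  have bi1 : b i1 != 0 by apply: contra ni1 => /eqP /b'b /eqP.
  have s'0 : \sum_i b' i * pi (a i) = 0.
    by apply: (IH' b' i0) => //; rewrite /b' mulrC subrr.
  have: \sum_i (b' i1 * b i - b i1 * b' i) * pi (a i) = 0.
    apply: (IH' _ i1 bi1) => [|i bi|t tG]; first by rewrite mulrC subrr.
      by rewrite bi (b'b _ bi) !mulr0 subrr.
    by rewrite comb_rel b'rel // brel // !mulr0 subrr.
  by rewrite comb_rel s'0 mulr0 subr0 => /mpoly_field_domain; apply.
have {}prop s i : s \in G -> b i0 * mact s (b i) = mact s (b i0) * b i.
  move=> /prop; rewrite negb_exists => /forallP/(_ i); rewrite negbK subr_eq0.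
  by move/eqP.
have act_neq0 s x : s \in G -> x != 0 -> mact s x != 0.
  move=> sG; apply: contra => /eqP/(congr1 (mact (invmx s))).
  by rewrite mactM mulVmx ?GU // mact1 rmorph0 => ->.
(* [M * b i0] is the norm of [b i0]. As the ratios [b i / b i0] are invariant, so is each [M * b i],
   which can therefore be moved into [pi]. *)
pose M := \prod_(s <- rem 1%:M (undup G)) mact s (b i0).
have ME : M * b i0 = \prod_(s <- undup G) mact s (b i0).
  by rewrite (big_rem 1%:M) ?mem_undup //= mact1 mulrC.
have Nneq0 : M * b i0 != 0.
  by rewrite ME big_seq; apply: prod_mpoly_neq0 => s; rewrite mem_undup => sG; exact: act_neq0.
have M0 : M != 0 by apply: contra Nneq0 => /eqP ->; rewrite mul0r.
have Ninv s : s \in G -> mact s (M * b i0) = M * b i0.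
  move=> sG; rewrite ME rmorph_prod; under eq_bigr => t _ do rewrite /= mactM.
  apply: (prod_mulmx (fun t => mact t (b i0))); rewrite ?undup_uniq ?GU // => t.
  by rewrite !mem_undup; exact: GM.
have dinv i : is_invariant (fun s => s \in G) (M * b i).
  move=> s sG; apply/eqP; rewrite -subr_eq0; apply/eqP.
  apply: mpoly_field_domain bi0; rewrite mulrBr rmorphM /= mulrCA prop // mulrA.
  by rewrite -rmorphM /= Ninv // [M * b i0]mulrC -mulrA subrr.
apply: mpoly_field_domain M0; rewrite mulr_sumr.
under eq_bigr => i _ do rewrite mulrA -(piM _ (dinv i)).
rewrite -summand_map_sum -[RHS]summand_map0; congr pi.
(* The relation for the identity matrix makes the argument of [pi] vanish. *)
under eq_bigr => i _ do rewrite -mulrA -[a i]mact1.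
by rewrite -mulr_sumr brel // mulr0.
Qed.

End Artin.

Lemma invariant_linear_conjugates_seq (G : seq 'M[k]_n) (pi : A -> A) (r1 r2 : seq (A * A)) :
    finite_matrix_group G ->
    (forall f g, pi (f + g) = pi f + pi g) ->
    (forall a f, is_invariant (fun s => s \in G) a -> pi (a * f) = a * pi f) ->
    (forall s, s \in G ->
       \sum_(p <- r1) p.1 * mact s p.2 = \sum_(p <- r2) p.1 * mact s p.2) ->
  \sum_(p <- r1) p.1 * pi p.2 = \sum_(p <- r2) p.1 * pi p.2.
Proof.
move=> gG piD piM rel; pose r := r1 ++ [seq (- p.1, p.2) | p <- r2].
have sumE (F : A -> A) : \sum_(p <- r) p.1 * F p.2 =
    \sum_(p <- r1) p.1 * F p.2 - \sum_(p <- r2) p.1 * F p.2.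
  rewrite big_cat big_map /= -sumrN; congr (_ + _).
  by apply: eq_bigr => p _; rewrite mulNr.
apply/eqP; rewrite -subr_eq0 -(sumE pi) big_tnth; apply/eqP.
pose x (i : 'I_(size r)) := tnth (in_tuple r) i.
apply: (invariant_linear_conjugates gG piD piM
  (a := fun i => (x i).2) (b := fun i => (x i).1)) => s sG.
by rewrite -(big_tnth _ _ r predT (fun p => p.1 * mact s p.2)) sumE rel // subrr.
Qed.

(* With t = 'X, the i-th coordinate of c(t) = \sum_r t^r * (row r W), a curve in the row
   space of W on which no linear form vanishes unless it vanishes on the whole row space.
   It replaces a generic point, which need not exist over a finite field k. *)
Definition curve (W : 'M[k]_n) (i : nat) : {poly k} :=
  if insub i is Some i' then rVpoly (row i' W^T) else 0.

Definition curve_eval (W : 'M[k]_n) : A -> {poly k} :=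
  @meval k n {poly k} (@polyC k) (curve W).

HB.instance Definition _ W := GRing.RMorphism.copy (curve_eval W)
  (@meval k n {poly k} (@polyC k) (curve W)).

Lemma curve_eval_mconst W c : curve_eval W (mconst n c) = c%:P.
Proof. exact: (@meval_mconst k {poly k} n (@polyC k)). Qed.

Lemma curve_ord W (i : 'I_n) : curve W i = rVpoly (row i W^T).
Proof.
by rewrite /curve; case: insubP => [i' _ /val_inj -> //|]; rewrite ltn_ord.
Qed.

Lemma curve_eval_mvar W (i : 'I_n) : curve_eval W (mvar k n i) = curve W i.
Proof. exact: (@meval_mvar k {poly k} n (@polyC k)). Qed.

Lemma curve_mulmx W s (i : 'I_n) :
  curve (W *m s) i = \sum_(j < n) (s j i)%:P * curve W j.
Proof.
under eq_bigr => j _ do rewrite curve_ord mul_polyC -linearZ.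
rewrite curve_ord -linear_sum; congr rVpoly; apply/rowP => l.
rewrite summxE !mxE; apply: eq_bigr => j _.
by rewrite !mxE mulrC.
Qed.

Lemma curve_eval_mact W s f : curve_eval W (mact s f) = curve_eval (W *m s) f.
Proof.
apply: (@mpoly_rmorph_ext k {poly k} n (curve_eval W \o @mact k n s) (curve_eval (W *m s)))
  => [c|i lt_in] /=; first by rewrite mact_mconst !curve_eval_mconst.
rewrite -[i]/(val (Ordinal lt_in)) mact_mvar curve_eval_mvar curve_mulmx rmorph_sum.
by apply: eq_bigr => j _; rewrite rmorphM /= curve_eval_mconst curve_eval_mvar.
Qed.

(** * The separator of the stabilizer and the linear forms built from it *)

Section Stabilizer.

Variables (G : seq 'M[k]_n) (gG : finite_matrix_group G) (U : 'M[k]_n).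

Definition stabilizer := [seq s <- undup G | U *m s == U].
Local Notation H := stabilizer.

Lemma mem_stabilizer s : (s \in H) = (s \in G) && (U *m s == U).
Proof. by rewrite mem_filter mem_undup andbC. Qed.

Lemma stabilizer_group : finite_matrix_group H.
Proof.
case: gG => G1 GM GU; split=> [|s t|s]; rewrite !mem_stabilizer.
- by rewrite G1 mulmx1 eqxx.
- move=> /andP[sG /eqP sU] /andP[tG /eqP tU].
  by rewrite GM // mulmxA sU tU eqxx.
- by move=> /andP[/GU].
Qed.

(** The default 0 is taken only when [U *m s = U], a case excluded from the product in
    [separator]. *)
Definition moved_coordinate s : A :=
  if [pick i | [exists r, (U *m s) r i != U r i]] is Some i then mvar k n i else 0.

Lemma curve_eval_moved s : U *m s != U ->
  curve_eval (U *m s) (moved_coordinate s) != curve_eval U (moved_coordinate s).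
Proof.
move=> nUs; rewrite /moved_coordinate; case: pickP => [i /existsP[r nri]|none].
  rewrite !curve_eval_mvar !curve_ord; apply: contra nri => /eqP.
  by move/(can_inj (@rVpolyK _ _))/rowP/(_ r); rewrite !mxE => ->.
case/eqP: nUs; apply/matrixP => r i; apply/eqP; have := none i.
by move/negbT; rewrite negb_exists => /forallP/(_ r)/negbNE.
Qed.

Definition separator g : A :=
  \prod_(h1 <- H) \prod_(h2 <- H) \prod_(s <- undup G | U *m s != U)
    (mact (h1 *m s) (moved_coordinate s) - mact (g *m h2) (moved_coordinate s)).

(** The factor with [h1 = h2 = 1] and [s = g] is zero. *)
Lemma separator_out g : g \in G -> U *m g != U -> separator g = 0.
Proof.
have [H1 _ _] := stabilizer_group.
move=> gG' nUg; rewrite /separator (big_rem 1%:M) //= [X in X * _](big_rem 1%:M) //=.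
rewrite [X in X * _ * _](big_rem g) ?mem_undup //=.
by rewrite nUg mul1mx mulmx1 subrr !mul0r.
Qed.

Lemma uniq_stabilizer : uniq H.
Proof. by rewrite filter_uniq ?undup_uniq. Qed.

Lemma prod_stabilizer (F : 'M[k]_n -> A) h :
  h \in H -> \prod_(t <- H) F (h *m t) = \prod_(t <- H) F t.
Proof.
have [_ HM HU] := stabilizer_group => hH.
by apply: prod_mulmx; rewrite ?uniq_stabilizer ?HU // => t; exact: HM.
Qed.

(** Acting by [h] only reindexes the product over [h1]. *)
Lemma mact_separator h g : h \in H -> mact h (separator g) = separator (h *m g).
Proof.
move=> hH; rewrite rmorph_prod /= -[RHS](prod_stabilizer _ hH).
apply: eq_bigr => h1 _; rewrite rmorph_prod; apply: eq_bigr => h2 _.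
rewrite rmorph_prod; apply: eq_bigr => s _.
by rewrite rmorphB /= !mactM !mulmxA.
Qed.

(** Here [h] is absorbed by reindexing the product over [h2]. *)
Lemma separator_in h : h \in H -> separator h = separator 1%:M.
Proof.
move=> hH; apply: eq_bigr => h1 _.
rewrite -[RHS](prod_stabilizer _ hH); apply: eq_bigr => h2 _.
by rewrite mul1mx.
Qed.

(** Since [h1] and [h2] fix the curve, each factor becomes the nonzero difference of
    [curve_eval_moved], and [{poly k}] is a domain. *)
Lemma curve_eval_separator : curve_eval U (separator 1%:M) != 0.
Proof.
rewrite rmorph_prod prodf_seq_neq0; apply/allP => h1 h1H /=.
rewrite rmorph_prod prodf_seq_neq0; apply/allP => h2 h2H /=.
rewrite rmorph_prod prodf_seq_neq0; apply/allP => s sG /=; apply/implyP => nUs.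
rewrite rmorphB /= subr_eq0 !curve_eval_mact mul1mx mulmxA.
move: h1H h2H; rewrite !mem_stabilizer => /andP[_ /eqP ->] /andP[_ /eqP ->].
exact: curve_eval_moved.
Qed.

(** The list [r] does not depend on [g]: this is the shape to which Artin's argument applies. *)
Definition representable (F : 'M[k]_n -> A) :=
  exists r : seq (A * A), forall g, F g = \sum_(p <- r) p.1 * mact g p.2.

Lemma representable_prod (I : Type) (r : seq I) (P : pred I) (F : I -> 'M[k]_n -> A) :
    (forall i, P i -> representable (F i)) ->
  representable (fun g => \prod_(i <- r | P i) F i g).
Proof.
move=> repF; elim: r => [|i r [rr rrE]].
  by exists [:: (1, 1)] => g; rewrite big_nil big_seq1 /= rmorph1 mulr1.
have [Pi|nPi] := boolP (P i); last first.
  by exists rr => g; rewrite big_cons (negPf nPi) rrE.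
have [ri riE] := repF i Pi.
exists [seq (p.1 * q.1, p.2 * q.2) | p <- ri, q <- rr] => g.
rewrite big_cons Pi riE rrE big_allpairs_dep mulr_suml; apply: eq_bigr => p _.
by rewrite mulr_sumr; apply: eq_bigr => q _; rewrite /= rmorphM mulrACA.
Qed.

Lemma representable_separator : representable separator.
Proof.
apply: representable_prod => h1 _; apply: representable_prod => h2 _.
apply: representable_prod => s _.
exists [:: (mact (h1 *m s) (moved_coordinate s), 1);
           (-1, mact h2 (moved_coordinate s))] => g.
by rewrite big_cons big_seq1 /= rmorph1 mulr1 mulN1r mactM.
Qed.

(** Artin's argument reduces each identity wanted for [phi] to the one with [pi] replaced by an
    arbitrary [g] in G, where the values of [separator] decide it. *)
Lemma stabilizer_linear_form (pi : A -> A) f0 :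
    (forall f, is_invariant (fun s => s \in G) (pi f)) ->
    (forall f g, pi (f + g) = pi f + pi g) ->
    (forall a f, is_invariant (fun s => s \in G) a -> pi (a * f) = a * pi f) ->
    pi f0 = 1 ->
  exists phi : A -> A,
    [/\ forall f, is_invariant (fun s => s \in H) (phi f),
        forall f g, phi (f + g) = phi f + phi g,
        forall a f, is_invariant (fun s => s \in H) a -> phi (a * f) = a * phi f &
        curve_eval U (phi 1) != 0].
Proof.
move=> piG piD piM pif0; have [G1 GM GU] := gG; have [H1 HM HU] := stabilizer_group.
have conj := invariant_linear_conjugates_seq gG piD piM.
have [r rE] := representable_separator.
pose phi t f := \sum_(p <- r) p.1 * pi (mact t (p.2 * f) * f0).
(* With [mact g] in place of [pi], the sum defining [phi t f] collapses to a multiple of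
   [separator (g *m t)]. *)
have relE g t f : \sum_(p <- r) p.1 * mact g (mact t (p.2 * f) * f0) =
    separator (g *m t) * (mact (g *m t) f * mact g f0).
  rewrite rE mulr_suml; apply: eq_bigr => p _.
  by rewrite !rmorphM /= !mactM -!mulrA.
have phi_inv t f : t \in G -> is_invariant (fun s => s \in H) (phi t f).
  move=> tG h hH; have := hH; rewrite mem_stabilizer => /andP[hG /eqP hU].
  (* The values of [pi] are invariant, so [h] acts on the coefficients [p.1] alone; [mact_separator]
     then compares the two lists. *)
  pose r1 := [seq (mact h p.1, mact t (p.2 * f) * f0) | p <- r].
  pose r2 := [seq (p.1, mact t (p.2 * f) * f0) | p <- r].
  have := conj r1 r2; rewrite !big_map /= /phi rmorph_sum => <-.
    by apply: eq_bigr => p _; rewrite rmorphM; congr (_ * _); exact: piG.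
  move=> g gG'; rewrite !big_map /= relE.
  have -> : separator (g *m t) = mact h (separator (invmx h *m (g *m t))).
    by rewrite mact_separator // mulmxA mulmxV ?mul1mx ?GU.
  rewrite rE rmorph_sum mulr_suml; apply: eq_bigr => p _.
  by rewrite !rmorphM /= !mactM !mulmxA mulmxV ?GU // mul1mx !mulrA.
have phiM t a f : t \in G -> is_invariant (fun s => s \in H) a ->
    phi t (a * f) = a * phi t f.
  move=> tG ainv.
  pose r1 := [seq (p.1, mact t (p.2 * (a * f)) * f0) | p <- r].
  pose r2 := [seq (a * p.1, mact t (p.2 * f) * f0) | p <- r].
  have := conj r1 r2; rewrite !big_map /= => eq12; rewrite /phi eq12.
    by rewrite mulr_sumr; apply: eq_bigr => p _; rewrite mulrA.
  move=> g gG'; rewrite !big_map /= relE.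
  under [RHS]eq_bigr => p _ do rewrite -mulrA.
  rewrite -mulr_sumr relE rmorphM /=.
  (* If [g *m t] lies in the stabilizer, it fixes [a]; otherwise the separator makes both sides
     zero. *)
  have [gtU|gtU] := eqVneq (U *m (g *m t)) U.
    rewrite [mact (g *m t) a]ainv; last by rewrite mem_stabilizer GM // gtU eqxx.
    by rewrite -mulrA mulrCA.
  by rewrite separator_out ?GM // !mul0r mulr0.
(* The images [U *m g] index the cosets [H g], and [rep] picks an element of each. *)
pose images := undup [seq U *m g | g <- G].
pose rep W := nth 1%:M G (index W [seq U *m g | g <- G]).
have repP W : W \in images -> rep W \in G /\ U *m rep W = W.
  rewrite mem_undup => WU; have lt : (index W [seq U *m g | g <- G] < size G)%N.
    by rewrite -(size_map (mulmx U)) index_mem.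
  by split; [exact: mem_nth | rewrite -(nth_map _ 0) // nth_index].
have sumE : separator 1%:M = \sum_(W <- images) phi (invmx (rep W)) 1.
  pose r2 := [seq (p.1, mact (invmx (rep W)) (p.2 * 1) * f0) | W <- images, p <- r].
  have := conj [:: (separator 1%:M, f0)] r2.
  rewrite big_seq1 big_allpairs_dep /= pif0 mulr1 => -> // g gG'.
  rewrite big_seq1 big_allpairs_dep /=.
  under eq_bigr => W _ do rewrite relE rmorph1 mul1r.
  have Ug : U *m g \in images by rewrite mem_undup; apply: map_f.
  (* Only [W = U *m g] contributes, since [g *m invmx (rep W)] fixes [U] exactly for this [W]. *)
  rewrite (bigD1_seq _ Ug) ?undup_uniq //= big_seq_cond big1 => [|W /andP[/repP[rG rU] nW]].
    have [rG rU] := repP _ Ug.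
    rewrite addr0 (@separator_in (g *m _)) // mem_stabilizer GM ?finite_matrix_group_inv //=.
    by rewrite mulmxA -{1}rU mulmxK ?GU.
  rewrite separator_out ?mul0r // ?GM ?finite_matrix_group_inv //.
  apply: contra nW => /eqP eqU; by rewrite -rU -{1}eqU mulmxA mulmxKV ?GU.
have /hasP[W Wim phiW] : has (fun W => curve_eval U (phi (invmx (rep W)) 1) != 0) images.
  apply: contraNT curve_eval_separator => /hasPn none; rewrite sumE rmorph_sum.
  by rewrite big_seq big1 // => W /none /negbNE /eqP.
have tG : invmx (rep W) \in G by apply: finite_matrix_group_inv => //; case: (repP _ Wim).
exists (phi (invmx (rep W))); split=> // [f|f g|a f ainv]; [exact: phi_inv| |exact: phiM].
rewrite /phi -big_split; apply: eq_bigr => p _.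
by rewrite /= mulrDr rmorphD mulrDl piD mulrDr.
Qed.

End Stabilizer.

(** * Translations along polynomial curves *)

Implicit Types (v : nat -> {poly k}).

(** The map f(x) |-> f(x + v(t)), the outer variable ['X] being the curve parameter t. *)
Definition translate v : A -> {poly A} :=
  @meval k n {poly A} (@polyC A \o @mconst k n)
    (fun i => (mvar k n i)%:P + map_poly (@mconst k n) (v i)).

HB.instance Definition _ v := GRing.RMorphism.copy (translate v)
  (@meval k n {poly A} (@polyC A \o @mconst k n)
    (fun i => (mvar k n i)%:P + map_poly (@mconst k n) (v i))).

Lemma translate_mconst v c : translate v (mconst n c) = (mconst n c)%:P.
Proof. exact: (@meval_mconst k {poly A} n (@polyC A \o @mconst k n)). Qed.

Lemma translate_mvar v i : (i < n)%N ->
  translate v (mvar k n i) = (mvar k n i)%:P + map_poly (@mconst k n) (v i).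
Proof. exact: (@meval_mvar k {poly A} n (@polyC A \o @mconst k n)). Qed.

(** The hypothesis says that [s] fixes the curve [v], so both composites agree on the variables. *)
Lemma mact_translate v s f :
    (forall i : 'I_n, \sum_(j < n) (s j i)%:P * v j = v i) ->
  map_poly (mact s) (translate v f) = translate v (mact s f).
Proof.
move=> vs; apply: (@mpoly_rmorph_ext k {poly A} n
  (map_poly (@mact k n s) \o translate v) (translate v \o @mact k n s)) => [c|i lt_in] /=.
  by rewrite mact_mconst translate_mconst map_polyC /= mact_mconst.
rewrite translate_mvar // rmorphD /= map_polyC /= -map_poly_comp /=.
under eq_map_poly => c do rewrite /= mact_mconst.
rewrite -[i]/(val (Ordinal lt_in)) -vs mact_mvar [RHS]rmorph_sum [in LHS]rmorph_sum.
rewrite /= [X in _ + X]rmorph_sum -big_split; apply: eq_bigr => j _ /=.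
by rewrite !rmorphM /= map_polyC translate_mconst translate_mvar // mulrDr.
Qed.

(** Extends [translate v] to a morphism fixing ['X], so that translations along curves can be
    composed. *)
Definition translate_poly v : {poly A} -> {poly A} :=
  horner_eval 'X \o map_poly (translate v).

HB.instance Definition _ v := GRing.RMorphism.copy (translate_poly v)
  (horner_eval 'X \o map_poly (translate v)).

Lemma translate_polyC v f : translate_poly v f%:P = translate v f.
Proof. by rewrite /translate_poly /horner_eval /= map_polyC hornerC. Qed.

Lemma translate_polyX v : translate_poly v 'X = 'X.
Proof. by rewrite /translate_poly /horner_eval /= map_polyX hornerX. Qed.

Lemma translate_polyK v f : translate_poly v (translate (fun i => - v i) f) = f%:P.
Proof.
apply: (@mpoly_rmorph_ext k {poly A} n
  (translate_poly v \o translate (fun i => - v i)) (@polyC A)) => [c|i lt_in] /=.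
  by rewrite translate_mconst translate_polyC translate_mconst.
rewrite translate_mvar // rmorphD /= translate_polyC translate_mvar // -addrA.
rewrite -[RHS]addr0; congr (_ + _); rewrite rmorphN rmorphN /=.
apply/eqP; rewrite subr_eq0; apply/eqP.
elim/poly_ind: (v i) => [|p c IHp]; first by rewrite !rmorph0.
rewrite !(rmorphD, rmorphM) /= -IHp !map_polyX !map_polyC /= translate_polyX.
by rewrite translate_polyC translate_mconst.
Qed.

Lemma mact_translate_poly v s (p : {poly A}) :
    (forall i : 'I_n, \sum_(j < n) (s j i)%:P * v j = v i) ->
  map_poly (mact s) (translate_poly v p) = translate_poly v (map_poly (mact s) p).
Proof.
move=> vs; elim/poly_ind: p => [|p c IHp]; first by rewrite !rmorph0.
rewrite !(rmorphD, rmorphM) /= IHp !(translate_polyX, map_polyX, map_polyC) /=.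
by rewrite !translate_polyC mact_translate.
Qed.

Definition eval0 : A -> k := @meval k n k idfun (fun=> 0).

HB.instance Definition _ := GRing.RMorphism.copy eval0 (@meval k n k idfun (fun=> 0)).

Lemma eval0_mconst c : eval0 (mconst n c) = c.
Proof. exact: (@meval_mconst k k n idfun). Qed.

Lemma eval0_mvar i : (i < n)%N -> eval0 (mvar k n i) = 0.
Proof. exact: (@meval_mvar k k n idfun). Qed.

(** At x = 0 the translate f(x + v(t)) becomes f(v(t)), which turns values on the curve into
    constant terms. *)
Lemma eval0_translate v f : map_poly eval0 (translate v f) = meval (@polyC k) v f.
Proof.
apply: (@mpoly_rmorph_ext k {poly k} n (map_poly eval0 \o translate v)
  (@meval k n {poly k} (@polyC k) v)) => [c|i lt_in] /=.
  rewrite translate_mconst map_polyC /= eval0_mconst.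
  exact/esym/(@meval_mconst k {poly k} n (@polyC k)).
rewrite translate_mvar // rmorphD /= map_polyC /= eval0_mvar // add0r -map_poly_comp.
rewrite [RHS](@meval_mvar k {poly k} n (@polyC k)) //.
by rewrite map_poly_id // => c _ /=; exact: eval0_mconst.
Qed.

Lemma map_poly_linear (P : 'M[k]_n -> Prop) (phi : {additive A -> A}) (b p : {poly A}) :
    (forall a f, is_invariant P a -> phi (a * f) = a * phi f) ->
    (forall i, is_invariant P b`_i) ->
  map_poly phi (b * p) = b * map_poly phi p.
Proof.
move=> phiM binv; apply/polyP => i; rewrite coef_map !coefM raddf_sum.
by apply: eq_bigr => j _; rewrite coef_map phiM.
Qed.

(* Conjugating the coefficientwise extension of phi by the translation by v is still
   linear over the invariants of any group fixing v. *)
Lemma translated_form (P : 'M[k]_n -> Prop) (phi : {additive A -> A}) v d :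
    (forall s, P s -> forall i : 'I_n, \sum_(j < n) (s j i)%:P * v j = v i) ->
    (forall f, is_invariant P (phi f)) ->
    (forall a f, is_invariant P a -> phi (a * f) = a * phi f) ->
  exists psi : {additive A -> A},
    [/\ forall f, is_invariant P (psi f),
        forall a f, is_invariant P a -> psi (a * f) = a * psi f &
        eval0 (psi 1) = (meval (@polyC k) v (phi 1))`_d].
Proof.
move=> vP phiP phiM; pose w i := - v i.
have wP s : P s -> forall i : 'I_n, \sum_(j < n) (s j i)%:P * w j = w i.
  move=> Ps i; rewrite /w -(vP _ Ps) -sumrN.
  by apply: eq_bigr => j _; rewrite mulrN.
pose psi f := (translate_poly v (map_poly phi (translate w f)))`_d.
have psiB : zmod_morphism psi by move=> f g; rewrite /psi !raddfB coefB.
pose psiA : {additive A -> A} := HB.pack psi (GRing.isZmodMorphism.Build _ _ psi psiB).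
exists psiA; split=> [f s Ps|a f ainv|] /=; rewrite /psi.
- rewrite -coef_map mact_translate_poly; last exact: vP.
  congr (translate_poly v _)`_d; apply/polyP => i; rewrite !coef_map; exact: phiP.
(* The translate of [a] along [w] has invariant coefficients, so it passes through [phi];
   translating back yields the constant polynomial [a], which commutes with taking a coefficient. *)
- rewrite rmorphM /= (map_poly_linear (P := P)) // => [|i s Ps].
    by rewrite rmorphM /= translate_polyK coefCM.
  by rewrite -coef_map mact_translate ?ainv //; exact: wP.
- rewrite rmorph1 -[1]/(1%:P) map_polyC translate_polyC.
  by rewrite -coef_map eval0_translate.
Qed.

(** * Homogeneous components through scaling of the variables *)

Definition scale_vars : A -> {poly A} :=
  @meval k n {poly A} (@polyC A \o @mconst k n) (fun i => (mvar k n i)%:P * 'X).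

HB.instance Definition _ := GRing.RMorphism.copy scale_vars
  (@meval k n {poly A} (@polyC A \o @mconst k n) (fun i => (mvar k n i)%:P * 'X)).

Lemma scale_vars_mconst c : scale_vars (mconst n c) = (mconst n c)%:P.
Proof. exact: (@meval_mconst k {poly A} n (@polyC A \o @mconst k n)). Qed.

Lemma scale_vars_mvar i : (i < n)%N -> scale_vars (mvar k n i) = (mvar k n i)%:P * 'X.
Proof. exact: (@meval_mvar k {poly A} n (@polyC A \o @mconst k n)). Qed.

Definition hcomp d f : A := (scale_vars f)`_d.

Lemma mact_scale_vars s f : map_poly (mact s) (scale_vars f) = scale_vars (mact s f).
Proof.
apply: (@mpoly_rmorph_ext k {poly A} n
  (map_poly (@mact k n s) \o scale_vars) (scale_vars \o @mact k n s)) => [c|i lt_in] /=.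
  by rewrite mact_mconst scale_vars_mconst map_polyC /= mact_mconst.
rewrite scale_vars_mvar // rmorphM /= map_polyC map_polyX /=.
rewrite -[i]/(val (Ordinal lt_in)) mact_mvar !rmorph_sum mulr_suml; apply: eq_bigr => j _ /=.
by rewrite !rmorphM /= scale_vars_mconst scale_vars_mvar // mulrA.
Qed.

Lemma mact_hcomp s d f : mact s (hcomp d f) = hcomp d (mact s f).
Proof. by rewrite /hcomp -mact_scale_vars coef_map. Qed.

Lemma scale_vars_horner1 f : (scale_vars f).[1] = f.
Proof.
apply: (@mpoly_rmorph_ext k A n (horner_eval 1 \o scale_vars) idfun) => [c|i lt_in];
  rewrite /= /horner_eval.
  by rewrite scale_vars_mconst hornerC.
by rewrite scale_vars_mvar // hornerMX hornerC mulr1.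
Qed.

Lemma hcomp0 f : hcomp 0 f = mconst n (eval0 f).
Proof.
rewrite /hcomp -horner_coef0.
apply: (@mpoly_rmorph_ext k A n (horner_eval 0 \o scale_vars) (@mconst k n \o eval0))
  => [c|i lt_in]; rewrite /= /horner_eval.
  by rewrite scale_vars_mconst hornerC eval0_mconst.
by rewrite scale_vars_mvar // hornerMX mulr0 eval0_mvar // rmorph0.
Qed.

End LinearAction.

(** Brings components into the recursive shape of [mhomog]: the [i]-th power of the last variable
    uses up [i] of the degree [d]. *)
Lemma hcompS (k : fieldType) n d (p : mpoly k n.+1) i :
  (hcomp d p : {poly mpoly k n})`_i =
  if (i <= d)%N then hcomp (d - i) ((p : {poly mpoly k n})`_i) else 0.
Proof.
pose B : comNzRingType := mpoly k n.
pose C : comNzRingType := mpoly k n.+1.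
pose s i := (mvar k n.+1 i)%:P * 'X : {poly C}.
(* On the first [n] variables, scaling is that of [mpoly k n], embedded by constants. *)
have lowE q : @meval k n {poly C} (@polyC C \o @mconst k n.+1) s q =
    map_poly (@polyC B) (scale_vars q).
  refine (@mpoly_rmorph_ext k {poly C} n
    (@meval k n {poly C} (@polyC C \o @mconst k n.+1) s)
    (map_poly (@polyC B) \o @scale_vars k n) _ _ q) => [c|j lt_jn] /=.
    rewrite scale_vars_mconst map_polyC.
    exact: (@meval_mconst k {poly C} n (@polyC C \o @mconst k n.+1)).
  rewrite [LHS](@meval_mvar k {poly C} n (@polyC C \o @mconst k n.+1)) //.
  rewrite scale_vars_mvar // rmorphM /= map_polyC map_polyX /s /=.
  by case: eqP lt_jn => // ->; rewrite ltnn.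
rewrite /hcomp /scale_vars.
rewrite (@mevalS k {poly C} n (@polyC C \o @mconst k n.+1)).
(* The range is enlarged to contain [i] even when [i] is beyond the size of [p]. *)
rewrite (@horner_coef_wide _ (maxn i.+1 (size (p : {poly B})))); last first.
  exact: leq_trans (size_poly _ _) (leq_maxr _ _).
rewrite coef_sum coef_sum.
have lt_i : (i < maxn i.+1 (size (p : {poly B})))%N by rewrite leq_max leqnn.
have termE j : (((map_poly (@meval k n {poly C} (@polyC C \o @mconst k n.+1) s)
      (p : {poly B}))`_j * ((mvar k n.+1 n)%:P * 'X) ^+ j : {poly C})`_d : {poly B})`_i =
    if (j <= d)%N && (i == j) then hcomp (d - j) ((p : {poly B})`_j) else 0.
  rewrite coef_map /= lowE eqxx exprMn mulrCA -rmorphXn coefCM coefMXn.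
  rewrite ltnNge; case: leqP => _ /=; last by rewrite mulr0 coef0.
  rewrite coef_map coefMC coefXn /hcomp.
  by case: (i == j); rewrite ?mul1r ?mul0r.
rewrite (bigD1 (Ordinal lt_i)) //= big1 => [|j nij].
  by rewrite addr0 [LHS]termE eqxx andbT.
rewrite [LHS]termE; case: eqP => [ij|]; last by rewrite andbF.
by case/eqP: nij; apply: val_inj.
Qed.

Lemma hcomp_mhomog (k : fieldType) n d (f : mpoly k n) : mhomog d (hcomp d f).
Proof.
elim: n d f => [|n IH] d f /=.
  by case: d => [|d]; rewrite ?orbT // /hcomp /scale_vars /= coefC eqxx.
apply/forallP => i; rewrite hcompS; case: leqP => _; last by rewrite eqxx.
by rewrite IH orbT.
Qed.

Lemma mhomog_hcomp (k : fieldType) n d j (f : mpoly k n) :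
  mhomog d f -> hcomp j f = if j == d then f else 0.
Proof.
elim: n d j f => [|n IH] d j f /=.
  rewrite /hcomp /scale_vars /= coefC => /orP[/eqP->|/eqP-> //].
  by rewrite !if_same.
move=> /forallP homf; apply/polyP => i; rewrite hcompS.
have -> : (if j == d then f else 0 : {poly mpoly k n})`_i =
          if j == d then (f : {poly mpoly k n})`_i else 0.
  by case: eqP; rewrite ?coef0.
have [lt_i|le_i] := ltnP i (size (f : {poly mpoly k n})); last first.
  by rewrite nth_default // /hcomp rmorph0 coef0 !if_same.
have := homf (Ordinal lt_i); rewrite /=.
case/orP=> [/eqP->|/andP[le_id /IH homi]].
  by rewrite /hcomp rmorph0 coef0 !if_same.
case: leqP => [le_ij|lt_ji]; first by rewrite homi -(eqn_add2r i) !subnK.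
by case: eqP => // jd; rewrite jd ltnNge le_id in lt_ji.
Qed.

(** * The degree 0 part of a linear map *)

Section DegreeZeroPart.

Variables (k : fieldType) (n : nat) (P : 'M[k]_n -> Prop).
Local Notation A := (mpoly k n).
Variable phi : {additive A -> A}.
Hypothesis phiP : forall f, is_invariant P (phi f).
Hypothesis phiM : forall a f, is_invariant P a -> phi (a * f) = a * phi f.

Definition hcomp_poly (p : {poly A}) : {poly A} :=
  \poly_(d < size p) hcomp d (phi p`_d).

Lemma coef_hcomp_poly p d : (hcomp_poly p)`_d = hcomp d (phi p`_d).
Proof.
rewrite coef_poly; case: ltnP => // le_pd.
by rewrite nth_default // raddf0 /hcomp rmorph0 coef0.
Qed.

(** Evaluation at 1 sums the coefficients, giving \sum_d (phi f_d)_d with subscripts for homogeneous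
    components. *)
Definition degree0_part f := (hcomp_poly (scale_vars f)).[1].

Lemma degree0_partD f g : degree0_part (f + g) = degree0_part f + degree0_part g.
Proof.
rewrite -hornerD; congr _.[1]; apply/polyP => d.
by rewrite coefD !coef_hcomp_poly rmorphD coefD raddfD /hcomp rmorphD coefD.
Qed.

Lemma hcompM_hcomp i d a f : (i <= d)%N ->
  hcomp d (hcomp i a * f) = hcomp i a * @hcomp k n (d - i) f.
Proof.
move=> le_id; rewrite {1}/hcomp rmorphM /=.
have -> : scale_vars (hcomp i a) = (hcomp i a)%:P * 'X^i.
  apply/polyP => j; rewrite coefCM coefXn.
  rewrite -[LHS]/(hcomp j (hcomp i a)) (mhomog_hcomp j (hcomp_mhomog i a)).
  by case: eqP; rewrite ?mulr1 ?mulr0.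
by rewrite -mulrA coefCM coefXnM ltnNge le_id.
Qed.

Lemma invariant_hcomp d a : is_invariant P a -> is_invariant P (hcomp d a).
Proof. by move=> ainv s Ps; rewrite mact_hcomp ainv. Qed.

(** Components of an invariant are invariant, so [phi] is linear over each, and multiplying by the
    one of degree [i] shifts components by [i]. *)
Lemma degree0_partM a f :
  is_invariant P a -> degree0_part (a * f) = a * degree0_part f.
Proof.
move=> ainv; rewrite -{2}[a]scale_vars_horner1 -hornerM; congr _.[1].
apply/polyP => d; rewrite coef_hcomp_poly rmorphM !coefM raddf_sum /hcomp rmorph_sum coef_sum.
apply: eq_bigr => i _; rewrite coef_hcomp_poly phiM; last exact: invariant_hcomp.
by apply: hcompM_hcomp; rewrite -ltnS.
Qed.

Lemma degree0_part_invariant f : is_invariant P (degree0_part f).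
Proof.
move=> s Ps; rewrite /degree0_part -horner_map /= rmorph1; congr _.[1].
apply/polyP => d; rewrite coef_map coef_hcomp_poly.
exact: (invariant_hcomp d (phiP _)).
Qed.

Lemma degree0_part_mhomog d f : mhomog d f -> mhomog d (degree0_part f).
Proof.
move=> homf; have -> : degree0_part f = hcomp d (phi f); last exact: hcomp_mhomog.
rewrite -[RHS](hornerC _ 1) -[RHS]mulr1 -[X in _ * X](expr1n _ d) -hornerXn -hornerM.
congr _.[1]; apply/polyP => j; rewrite coef_hcomp_poly coefCM coefXn.
rewrite -/(hcomp j f) (mhomog_hcomp j homf).
by case: eqP => [->|_]; rewrite ?mulr1 ?mulr0 ?raddf0 // /hcomp rmorph0 coef0.
Qed.

Lemma degree0_part1 : degree0_part 1 = mconst n (eval0 (phi 1)).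
Proof.
rewrite -hcomp0 -[RHS](hornerC _ 1); congr _.[1]; apply/polyP => d.
rewrite coef_hcomp_poly rmorph1 coefC coef1.
by case: eqP => [->//|_]; rewrite raddf0 /hcomp rmorph0 coef0.
Qed.

Lemma direct_summand_of_form : eval0 (phi 1) != 0 -> direct_summand_property P.
Proof.
move=> c0; exists degree0_part; split=> [||a f|g ginv|d f].
- exact: degree0_part_invariant.
- exact: degree0_partD.
- exact: degree0_partM.
(* As 1 is sent to a nonzero constant c, the element g / c is a preimage of [g]. *)
- exists (g * mconst n (eval0 (phi 1))^-1); rewrite degree0_partM //.
  rewrite -[mconst _ _]mulr1 degree0_partM => [|s _]; last exact: mact_mconst.
  by rewrite degree0_part1 -rmorphM mulVf // rmorph1 mulr1.
- exact: degree0_part_mhomog.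
Qed.

End DegreeZeroPart.

(** * Passage from the group to the point-stabilizer *)

Theorem theorem1 (k : fieldType) (n : nat) (G : seq 'M[k]_n) (U : 'M[k]_n) :
  1%:M \in G ->
  (forall A B, A \in G -> B \in G -> A *m B \in G) ->
  (forall A, A \in G -> A \in unitmx) ->
  direct_summand_property (fun s => s \in G) ->
  direct_summand_property
    (fun s => s \in G /\ (forall u : 'rV[k]_n, (u <= U)%MS -> u *m s = u)).
Proof.
move=> G1 GM GU [pi [piG piD piM pi_surj _]].
have gG : finite_matrix_group G by split.
set P := fun s => _ /\ _.
have PE s : P s <-> s \in stabilizer G U.
  rewrite mem_stabilizer; split=> [[-> fixU]|/andP[sG /eqP Us]].
    by apply/eqP/row_matrixP => i; rewrite row_mul fixU ?row_sub.
  by split=> // u /submxP[w ->]; rewrite -mulmxA Us.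
have invE f : is_invariant P f <-> is_invariant (fun s => s \in stabilizer G U) f.
  by split=> finv s /PE /finv.
have [f0 pif0] : exists f, pi f = 1 by apply: pi_surj => s _; exact: rmorph1.
have [phi [phiH phiD phiM phi1]] := stabilizer_linear_form gG U piG piD piM pif0.
have phiB : zmod_morphism phi.
  by move=> f g; apply/eqP; rewrite eq_sym subr_eq -phiD subrK.
pose phiA : {additive mpoly k n -> mpoly k n} :=
  HB.pack phi (GRing.isZmodMorphism.Build _ _ phi phiB).
have curveP s : P s -> forall i : 'I_n,
    \sum_(j < n) (s j i)%:P * curve U j = curve U i.
  by move=> /PE; rewrite mem_stabilizer => /andP[_ /eqP Us] i; rewrite -curve_mulmx Us.
(* The coefficient taken is the leading one, nonzero because [phi 1] does not vanish on the
   curve. *)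
have [|a f /invE|psi [psiP psiM psi1]] := @translated_form k n P phiA (curve U)
    (size (curve_eval U (phi 1))).-1 curveP.
- by move=> f; apply/invE; exact: phiH.
- exact: phiM.
apply: (direct_summand_of_form psiP psiM); rewrite psi1.
by rewrite [_`__](_ : _ = lead_coef (curve_eval U (phi 1))) // lead_coef_eq0.
Qed.
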